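(* Let $M_1,M_2$ be two finite monoids. For $i=1,2$ denote by $U_i$ the group of units of $M_i$ and by $k_i$ the rank of $M_i$ modulo $U_i$, and let $A'_i\subseteq M_i\setminus U_i$ be such that $|A'_i|=k_i$ and $M_i=\langle U_i\cup A'_i\rangle$. Let $B$ be a generating set of $U_1\times U_2$. Then the set $$C=B\cup (A'_1\times\{1\})\cup(\{1\}\times A'_2)$$ is a generating set of $M_1\times M_2$. Furthermore, $$\mathrm{rank}(M_1\times M_2)=\mathrm{rank}(U_1\times U_2)+k_1+k_2 .$$
   Context: A generating set of a finite semigroup $S$ is a non-empty subset $A\subseteq S$ such that every element of $S$ is a product of one or more elements of $A$, written $S=\langle A\rangle$; $\mathrm{rank}(S)$ is the smallest cardinality of a generating set (so the trivial group has rank $1$). Monoids and groups are regarded as semigroups here. For a finite monoid $M$ with group of units $U$, the rank of $M$ modulo $U$ is the minimum number of elements of $M\setminus U$ which together with $U$ generate $M$. *)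

(* Defs.v *)
From HB Require Import structures.
From mathcomp Require Import all_boot.
From mathcomp Require Import boolp.

Set Implicit Arguments.
Unset Strict Implicit.
Unset Printing Implicit Defensive.

Local Open Scope group_scope.

#[short(type="finSemigroupType")]
HB.structure Definition FinSemigroup := {S of Semigroup S & Finite S}.

#[short(type="finMonoidType")]
HB.structure Definition FinMonoid := {M of Monoid M & Finite M}.

HB.instance Definition _ (M N : finMonoidType) := Monoid.on (M * N)%type.

Section SemigroupRank.
Variable T : finSemigroupType.
Implicit Types (A S : {set T}) (x : T).

Definition is_product A x : Prop :=
  exists2 a, a \in A & exists2 s : seq T, {subset s <= A} & x = foldl *%g a s.

Definition sgen A : {set T} := [set x | `[< is_product A x >]].

(* S is meant to be a subsemigroup of T; S = [set: T] gives T itself. *)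
Definition generating_set A S : bool :=
  [&& A != set0, A \subset S & sgen A == S].

(* The default S of the arg min is a generating set of every nonempty
   subsemigroup S (rankP), so it never matters for those. *)
Definition rank S : nat := #|[arg min_(A < S | generating_set A S) #|A|]|.

End SemigroupRank.

Section Monoids.
Variable M : finMonoidType.

Definition unit_group : {set M} :=
  [set x | [exists y : M, (x * y == 1) && (y * x == 1)]].

Definition generates_mod_units (A : {set M}) : bool :=
  (A \subset ~: unit_group) && (sgen (unit_group :|: A) == [set: M]).

(* ~: unit_group satisfies generates_mod_units (rank_mod_unitsP). *)
Definition rank_mod_units : nat :=
  #|[arg min_(A < ~: unit_group | generates_mod_units A) #|A|]|.

End Monoids.

Arguments unit_group M : clear implicits.
Arguments rank_mod_units M : clear implicits.

Lemma mem_sgen (T : finSemigroupType) (A : {set T}) x : x \in A -> x \in sgen A.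
Proof.
by move=> Ax; rewrite inE; apply/asboolP; exists x => //; exists [::].
Qed.

Lemma rankP (T : finSemigroupType) (S : {set T}) :
    S != set0 -> {in S &, forall x y, x * y \in S} ->
  (exists2 A, generating_set A S & #|A| = rank S) /\
  (forall A, generating_set A S -> rank S <= #|A|).
Proof.
move=> S0 Smul; rewrite /rank; case: arg_minnP => [|A gA minA]; last first.
  by split=> //; exists A.
rewrite /generating_set S0 subxx /= eqEsubset; apply/andP; split.
  apply/subsetP => x; rewrite inE => /asboolP [a Sa [s sS ->]].
  elim: s a Sa sS => [|b s IHs] a Sa sS //=; apply: IHs => [|c cs].
    by apply: Smul => //; apply: sS; rewrite mem_head.
  by apply: sS; rewrite inE cs orbT.
by apply/subsetP => x /mem_sgen.
Qed.

Lemma rank_mod_unitsP (M : finMonoidType) :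
  (exists2 A : {set M}, generates_mod_units A & #|A| = rank_mod_units M) /\
  (forall A : {set M}, generates_mod_units A -> rank_mod_units M <= #|A|).
Proof.
rewrite /rank_mod_units; case: arg_minnP => [|A gA minA]; last first.
  by split=> //; exists A.
rewrite /generates_mod_units subxx setUCr /= eqEsubset subsetT.
by apply/subsetP => x /mem_sgen.
Qed.

(* Main.v *)
Require Import Defs.
From mathcomp Require Import all_boot.
From mathcomp Require Import boolp.
Set Implicit Arguments.
Unset Strict Implicit.
Unset Printing Implicit Defensive.
Local Open Scope group_scope.

(** The complement of the unit group of a finite monoid is an ideal: a factor
    of a unit is a unit.  So whenever a set generates a monoid, the generators
    dividing a unit already suffice to write that unit; more generally, members
    of a set closed under taking factors only need generators from that set
    ([sgen_factor_closed]).

    Let C be any generating set of M1 x M2, and sort its elements by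
    which of their coordinates are units.
    - Those in U1 x U2 generate U1 x U2, so they are at least
      rank (U1 x U2) in number.
    - An element (m, 1) is a product of elements of C whose second coordinates
      are units.  Projecting to M1, the elements of C with second coordinate a
      unit and first coordinate a non-unit generate M1 together with U1,
      so there are at least k1 of them.  By symmetry at least k2 elements
      have only their first coordinate a unit
      ([rank_mod_units_le_factor_closed] covers both).
    These three classes are disjoint, which gives the lower bound.

    Conversely (m1, m2) = (m1, 1) (1, m2), and each factor is a product of
    images of units, which lie in the subsemigroup generated by B, and of images
    of elements of A1 or A2; so the proposed set generates.  Taking
    for B a smallest generating set of U1 x U2 gives the upper bound. *)

Section Generation.
Variable T : finSemigroupType.
Implicit Types A C S F : {set T}.

Lemma sgen_ind A (P : T -> Prop) :
    (forall x, x \in A -> P x) -> (forall x y, P x -> P y -> P (x * y)) ->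
  forall x, x \in sgen A -> P x.
Proof.
move=> PA PM x; rewrite inE => /asboolP[a Aa [s sA ->]].
have: P a by exact: PA.
elim: s a {Aa} sA => [|b s IHs] a sA Pa //=; apply: IHs => [c cs|].
  by apply: sA; rewrite inE cs orbT.
by apply: PM => //; apply/PA/sA/mem_head.
Qed.

Lemma sgenM A x y : x \in sgen A -> y \in sgen A -> x * y \in sgen A.
Proof.
rewrite inE => /asboolP[a Aa [s sA ->]].
rewrite inE => /asboolP[b Ab [t tA ->]].
rewrite inE; apply/asboolP; exists a => //; exists (s ++ b :: t).
  move=> c; rewrite mem_cat inE => /or3P[/sA//|/eqP->//|/tA//].
rewrite foldl_cat /=.
have mul_foldl (u v : T) r : u * foldl *%g v r = foldl *%g (u * v) r.
  by elim: r v => //= w r IHr v; rewrite IHr mulgA.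
exact: mul_foldl.
Qed.

Lemma sgen_sub A C : A \subset sgen C -> sgen A \subset sgen C.
Proof.
move=> sAC; apply/subsetP; apply: sgen_ind => [x|x y]; last exact: sgenM.
exact: (subsetP sAC).
Qed.

Lemma sgenS A C : A \subset C -> sgen A \subset sgen C.
Proof.
by move=> sAC; apply/sgen_sub/subsetP => x Ax; apply/mem_sgen/(subsetP sAC).
Qed.

Lemma sgen_closed_sub A S :
  {in S &, forall x y, x * y \in S} -> A \subset S -> sgen A \subset S.
Proof.
move=> SM sAS; apply/subsetP; apply: sgen_ind => [x|x y]; last exact: SM.
exact: (subsetP sAS).
Qed.

Definition factor_closed F : Prop :=
  forall x y, x * y \in F -> (x \in F) && (y \in F).

(** All factors in an expression of an element of F as a product lie in F. *)
Lemma sgen_factor_closed A F x :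
  factor_closed F -> x \in sgen A -> x \in F -> x \in sgen (A :&: F).
Proof.
move=> fcF; move: x; apply: sgen_ind => [x Ax Fx|x y IHx IHy].
  by apply: mem_sgen; rewrite inE Ax.
by move=> /fcF/andP[/IHx + /IHy]; apply: sgenM.
Qed.

Lemma rank_le_factor_closed A F :
    F != set0 -> {in F &, forall x y, x * y \in F} -> factor_closed F ->
  sgen A = [set: T] -> rank F <= #|A :&: F|.
Proof.
move=> /[dup] F0 /set0Pn[z Fz] FM fcF genA.
have sFgen : F \subset sgen (A :&: F).
  by apply/subsetP => x; apply: sgen_factor_closed => //; rewrite genA inE.
apply: (rankP F0 FM).2; rewrite /generating_set subsetIr.
rewrite [sgen _ == _]eqEsubset sFgen sgen_closed_sub ?subsetIr //= andbT.
(* A generating set must be nonempty by definition: any z in F is a product,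
   whose first factor witnesses this. *)
have := subsetP sFgen z Fz; rewrite inE => /asboolP[a Aa _].
by apply/set0Pn; exists a.
Qed.

End Generation.

Lemma sgen_morph (S T : finSemigroupType) (f : S -> T) (A : {set S}) x :
  {morph f : x y / x * y} -> x \in sgen A -> f x \in sgen (f @: A).
Proof.
move=> fM; move: x; apply: sgen_ind => [x Ax|x y]; last by rewrite fM; apply: sgenM.
exact/mem_sgen/imset_f.
Qed.

Section Units.
Variable M : finMonoidType.
Implicit Types x y : M.

Lemma unit_group1 : 1 \in unit_group M.
Proof. by rewrite inE; apply/existsP; exists 1; rewrite mulg1 eqxx. Qed.

Lemma unit_groupM : {in unit_group M &, forall x y, x * y \in unit_group M}.
Proof.
move=> x y; rewrite !inE => /existsP[x' /andP[/eqP xx' /eqP x'x]].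
move=> /existsP[y' /andP[/eqP yy' /eqP y'y]]; apply/existsP; exists (y' * x').
by rewrite -mulgA (mulgA y) yy' mul1g xx' -mulgA (mulgA x') x'x mul1g y'y !eqxx.
Qed.

(** By finiteness: y is injective as a left multiplication, hence surjective,
    so it also has a right inverse. *)
Lemma one_sided_inverse x y : x * y = 1 -> y * x = 1.
Proof.
move=> xy1.
have [|g _ gK] := @injF_bij M (fun z => y * z).
  by move=> u v /(congr1 (fun w => x * w)); rewrite !mulgA xy1 !mul1g.
have yg1 : y * g 1 = 1 by exact: gK.
suff -> : x = g 1 by [].
by have := mulgA x y (g 1); rewrite yg1 xy1 mulg1 mul1g.
Qed.

Lemma unit_group_factor_closed : factor_closed (unit_group M).
Proof.
move=> x y; rewrite !inE => /existsP[z /andP[/eqP xyz /eqP zxy]].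
rewrite mulgA in zxy; rewrite -mulgA in xyz.
apply/andP; split; apply/existsP.
  by exists (y * z); rewrite xyz (one_sided_inverse xyz) eqxx.
by exists (z * x); rewrite zxy (one_sided_inverse zxy) eqxx.
Qed.

End Units.

(** Every element of M is the image of a product of generators from F; the
    generators of F with unit images contribute only units to this product, so
    only the others count towards the rank modulo units. *)
Lemma rank_mod_units_le_factor_closed (N : finSemigroupType) (M : finMonoidType)
    (f : N -> M) (F A : {set N}) :
    {morph f : x y / x * y} -> factor_closed F -> f @: F = [set: M] ->
    sgen A = [set: N] ->
  rank_mod_units M <= #|[set x in A :&: F | f x \notin unit_group M]|.
Proof.
move=> fM fcF fF genA; apply: leq_trans (leq_imset_card f _).
apply: (rank_mod_unitsP M).2; rewrite /generates_mod_units; apply/andP; split.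
  by apply/subsetP => _ /imsetP[x + ->]; rewrite !inE => /andP[].
rewrite eqEsubset subsetT; apply/subsetP => m _.
have /imsetP[x Fx ->] : m \in f @: F by rewrite fF inE.
have xA : x \in sgen (A :&: F) by apply: sgen_factor_closed; rewrite ?genA ?inE.
apply: subsetP (sgen_morph fM xA); apply: sgenS; apply/subsetP => _ /imsetP[y yAF ->].
have [Ufy|nUfy] := boolP (f y \in unit_group M); rewrite inE ?Ufy //.
by apply/orP; right; apply: imset_f; rewrite inE yAF.
Qed.

Section Product.
Variables M N : finMonoidType.

Lemma setXM (S : {set M}) (T : {set N}) :
    {in S &, forall x y, x * y \in S} -> {in T &, forall x y, x * y \in T} ->
  {in setX S T &, forall x y, x * y \in setX S T}.
Proof.
move=> SM TM [x x'] [y y'] /setXP[Sx Tx'] /setXP[Sy Ty'].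
by apply/setXP; split; [apply: SM | apply: TM].
Qed.

Lemma setX_factor_closed (S : {set M}) (T : {set N}) :
  factor_closed S -> factor_closed T -> factor_closed (setX S T).
Proof.
move=> fcS fcT [x x'] [y y'] /setXP[/fcS/andP[Sx Sy] /fcT/andP[Tx' Ty']].
by rewrite !inE Sx Sy Tx' Ty'.
Qed.

Lemma setT_factor_closed : factor_closed [set: M].
Proof. by move=> x y _; rewrite !inE. Qed.

End Product.

Section RankProduct.
Variables M1 M2 : finMonoidType.
Local Notation U1 := (unit_group M1).
Local Notation U2 := (unit_group M2).

Lemma generating_set_product (A1 : {set M1}) (A2 : {set M2})
    (B : {set M1 * M2}) :
    sgen (U1 :|: A1) = [set: M1] -> sgen (U2 :|: A2) = [set: M2] ->
    generating_set B (setX U1 U2) ->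
  generating_set (B :|: setX A1 [set 1] :|: setX [set 1] A2) [set: M1 * M2].
Proof.
move=> genA1 genA2 /and3P[/set0Pn[b Bb] _ /eqP genB].
set C := _ :|: _.
have UC : setX U1 U2 \subset sgen C.
  by rewrite -genB sgenS // /C -setUA subsetUl.
have inC1 m : (m, 1) \in sgen C.
  have mA1 : m \in sgen (U1 :|: A1) by rewrite genA1 inE.
  have injM : {morph (fun x : M1 => (x, 1 : M2)) : x y / x * y}.
    by move=> x y; congr (_, _); rewrite mulg1.
  apply: subsetP (sgen_morph injM mA1); apply: sgen_sub.
  apply/subsetP => _ /imsetP[x /setUP[Ux|Ax] ->].
    by apply: (subsetP UC); rewrite inE Ux unit_group1.
  by apply: mem_sgen; rewrite !inE Ax eqxx orbT.
have inC2 m : (1, m) \in sgen C.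
  have mA2 : m \in sgen (U2 :|: A2) by rewrite genA2 inE.
  have injM : {morph (fun x : M2 => (1 : M1, x)) : x y / x * y}.
    by move=> x y; congr (_, _); rewrite mulg1.
  apply: subsetP (sgen_morph injM mA2); apply: sgen_sub.
  apply/subsetP => _ /imsetP[x /setUP[Ux|Ax] ->].
    by apply: (subsetP UC); rewrite inE Ux unit_group1.
  by apply: mem_sgen; rewrite !inE Ax eqxx !orbT.
apply/and3P; split; rewrite ?subsetT //.
  by apply/set0Pn; exists b; rewrite !inE Bb.
rewrite eqEsubset subsetT; apply/subsetP => -[m1 m2] _.
have -> : (m1, m2) = (m1, 1) * (1, m2) :> M1 * M2.
  by congr (_, _); rewrite ?mulg1 ?mul1g.
exact: sgenM.
Qed.

Lemma rank_product_ge :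
  rank (setX U1 U2) + rank_mod_units M1 + rank_mod_units M2
    <= rank [set: M1 * M2].
Proof.
have T0 : [set: M1 * M2] != set0 by apply/set0Pn; exists 1; rewrite inE.
have [[C /and3P[_ _ /eqP genC] <-] _] := rankP T0 (fun x y _ _ => in_setT (x * y)).
have fcU1 := @unit_group_factor_closed M1.
have fcU2 := @unit_group_factor_closed M2.
have rU : rank (setX U1 U2) <= #|C :&: setX U1 U2|.
  apply: rank_le_factor_closed genC.
  - by apply/set0Pn; exists (1, 1); apply/setXP; rewrite !unit_group1.
  - exact: setXM (@unit_groupM M1) (@unit_groupM M2).
  - exact: setX_factor_closed.
have r1 : rank_mod_units M1
    <= #|[set x in C :&: setX setT U2 | x.1 \notin U1]|.
  apply: rank_mod_units_le_factor_closed genC => //.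
    exact: setX_factor_closed (@setT_factor_closed M1) fcU2.
  apply/setP => m; rewrite [RHS]inE; apply/imsetP; exists (m, 1) => //.
  by apply/setXP; rewrite in_setT unit_group1.
have r2 : rank_mod_units M2
    <= #|[set x in C :&: setX U1 setT | x.2 \notin U2]|.
  apply: rank_mod_units_le_factor_closed genC => //.
    exact: setX_factor_closed fcU1 (@setT_factor_closed M2).
  apply/setP => m; rewrite [RHS]inE; apply/imsetP; exists (1, m) => //.
  by apply/setXP; rewrite in_setT unit_group1.
apply: leq_trans (leq_add (leq_add rU r1) r2) _.
(* Splitting C first by the second coordinate, then by the first, isolates the
   three classes; pairs of two non-units are discarded. *)
rewrite -(cardsID (setX setT U2) C).
rewrite -(cardsID (setX U1 setT) (C :&: setX setT U2)).
apply: leq_add; first apply: leq_add; apply/subset_leq_card/subsetP => x;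
  rewrite !inE /= ?andbT.
- by move=> /and3P[-> -> ->].
- by move=> /andP[/andP[-> ->] ->].
- by move=> /andP[/andP[-> _] ->].
Qed.

End RankProduct.

Theorem lemma4p5 (M1 M2 : finMonoidType) (k1 k2 : nat)
    (A1 : {set M1}) (A2 : {set M2}) (B : {set M1 * M2})
    (hk1 : k1 = rank_mod_units M1) (hk2 : k2 = rank_mod_units M2)
    (sA1 : A1 \subset ~: unit_group M1) (sA2 : A2 \subset ~: unit_group M2)
    (cardA1 : #|A1| = k1) (cardA2 : #|A2| = k2)
    (genA1 : [set: M1] = sgen (unit_group M1 :|: A1))
    (genA2 : [set: M2] = sgen (unit_group M2 :|: A2))
    (genB : generating_set B (setX (unit_group M1) (unit_group M2))) :
  generating_set (B :|: setX A1 [set 1] :|: setX [set 1] A2) [set: M1 * M2]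
  /\ rank [set: M1 * M2]
     = (rank (setX (unit_group M1) (unit_group M2)) + k1 + k2)%N.
Proof.
split; first exact: generating_set_product.
apply/eqP; rewrite eqn_leq hk1 hk2 rank_product_ge andbT -hk1 -hk2.
have U0 : setX (unit_group M1) (unit_group M2) != set0.
  by apply/set0Pn; exists (1, 1); apply/setXP; rewrite !unit_group1.
have [[B' genB' <-] _] := rankP U0 (setXM (@unit_groupM M1) (@unit_groupM M2)).
have gen := generating_set_product (esym genA1) (esym genA2) genB'.
have T0 : [set: M1 * M2] != set0 by apply/set0Pn; exists 1; rewrite inE.
apply: leq_trans ((rankP T0 (fun x y _ _ => in_setT (x * y))).2 _ gen) _.
apply: leq_trans (leq_card_setU _ _) _.
apply: leq_add; last by rewrite cardsX cards1 mul1n cardA2.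
apply: leq_trans (leq_card_setU _ _) _.
by rewrite leq_add2l cardsX cards1 muln1 cardA1.
Qed.
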